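(* Let $k\in\mathbb N$, $c>0$ and $d>6+2\sqrt7$. There exists $\varepsilon=\varepsilon(d,c,k)>0$ such that the following holds. Suppose $G=(V,E)$ is an infinite connected graph with all degrees at most $k$ for which there exists an exhaustion $V_1\subseteq V_2\subseteq\cdots$ of $V$ (i.e. $\bigcup_n V_n=V$) by finite connected sets such that, for every $n$, the subgraph $G_n$ of $G$ induced by $V_n$ satisfies the isoperimetric inequality $(\mathrm{ID}_{d,c})$. Then Bernoulli-$p$ bond percolation on $G$ has a unique infinite cluster almost surely for every $p\ge 1-\varepsilon$.
   Context: A graph $H=(W,F)$ satisfies $(\mathrm{ID}_{d,c})$ if $|\partial_F K|\ge c\min\{|K|,|W\setminus K|\}^{(d-1)/d}$ for every finite $K\subseteq W$, where $\partial_F K$ is the set of edges of $H$ with exactly one endpoint in $K$. Bernoulli-$p$ bond percolation keeps each edge independently with probability $p$; clusters are connected components of the open subgraph. *)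

(* Defs.v *)
From HB Require Import structures.
From mathcomp Require Import all_boot all_order all_algebra finmap.
From mathcomp Require Import all_classical all_reals all_analysis.
Set Implicit Arguments. Unset Strict Implicit. Unset Printing Implicit Defensive.
Import Order.TTheory GRing.Theory Num.Theory.
Local Open Scope classical_set_scope.
Local Open Scope ring_scope.

(* A graph is given by a type of vertices V, a type of edges E and the
   endpoint map [ends : E -> V * V] (an edge is an unordered pair; the
   orientation chosen by [ends] is irrelevant). *)

Section Graphs.
Context {V E : choiceType} (ends : E -> V * V).

Definition joins (e : E) (u w : V) : Prop :=
  ends e = (u, w) \/ ends e = (w, u).

Definition simple_graph : Prop :=
  (forall e, (ends e).1 <> (ends e).2) /\
  (forall e1 e2, joins e1 (ends e2).1 (ends e2).2 -> e1 = e2).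

Definition incident (v : V) : set E := [set e | (ends e).1 = v \/ (ends e).2 = v].

Definition max_degree_le (k : nat) : Prop :=
  forall v, finite_set (incident v) /\ (#|` fset_set (incident v)| <= k)%N.

Inductive conn (S : E -> Prop) : V -> V -> Prop :=
| conn_refl v : conn S v v
| conn_step u w v e : S e -> joins e u w -> conn S w v -> conn S u v.

Definition connected_graph : Prop := forall u v, conn (fun _ => True) u v.

Definition induced_edges (W : set V) : E -> Prop :=
  fun e => W (ends e).1 /\ W (ends e).2.

Definition induced_connected (W : set V) : Prop :=
  forall u v, W u -> W v -> conn (induced_edges W) u v.

Definition induced_boundary (W K : set V) : set E :=
  [set e | induced_edges W e /\ (K (ends e).1 <-> ~ K (ends e).2)].

Definition induced_ID {R : realType} (W : set V) (d c : R) : Prop :=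
  forall K : set V, K `<=` W -> finite_set K ->
    c * ((minn #|` fset_set K| #|` fset_set (W `\` K)|)%:R `^ ((d - 1) / d))
      <= (#|` fset_set (induced_boundary W K)|)%:R.

Definition infinite_cluster (open : E -> Prop) (v : V) : Prop :=
  ~ finite_set [set u | conn open v u].

Definition unique_infinite_cluster (open : E -> Prop) : Prop :=
  (exists v, infinite_cluster open v) /\
  (forall u w, infinite_cluster open u -> infinite_cluster open w ->
     conn open u w).
End Graphs.

(* Bernoulli-p bond percolation on edge set E realised on a probability
   space: events [A e] ("e is open") that are measurable, have probability p
   and are mutually independent (product rule on every finite subfamily of
   distinct edges). *)
Definition bernoulli_bond_percolation {R : realType} {E : choiceType}
  {dT : measure_display} {T : measurableType dT} (P : probability T R)
  (p : R) (A : E -> set T) : Prop :=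
  (forall e, measurable (A e)) /\
  (forall e, P (A e) = p%:E) /\
  (forall s : seq E, uniq s ->
     P (\bigcap_(e in [set` s]) A e) = (\prod_(e <- s) fine (P (A e)))%:E).

(* Main.v *)
(** Peierls' argument, with the minimal cuts counted by Karger's contraction.

    Let [A] be a vertex set of a finite connected graph such that [A] and its
    complement are connected, and start from the partition into singletons.
    Repeatedly merge a smallest block [S] with a neighbour along a uniformly
    chosen edge of its boundary.  The edge avoids the boundary of [A] with
    probability [1 - a / b], where [b] is the size of the boundary of [S] and
    [a] that of its part in the boundary of [A].  By isoperimetry [b] is at
    least a power of the size of [S], and blocks at least double when they
    are merged, so each boundary edge of [A] pays a geometric series of costs
    and [A] survives as a union of blocks, until it becomes a block, with
    probability at least [exp (- K n)], [n] being the size of its boundary.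
    The block of a given vertex takes at most one value of each size; hence,
    for each [m], the sum of [exp (- K |bd A|)] over the sets [A] of size [m]
    containing that vertex is at most 1.  Consequently, for [1 - p] below a
    constant depending on [c] only, the probability that a given vertex lies in
    such an [A] with [N <= |A| <= |V_n| / 2] and closed boundary is [O(1/N)],
    uniformly in [n].

    Two disjoint infinite clusters produce such an [A] around one of two given
    vertices for every [N] and all large [n]; the absence of infinite clusters
    produces one containing [V_m] for every [m] and all large [n].  Both events
    are therefore null. *)

Require Import Defs.
From HB Require Import structures.
From mathcomp Require Import all_boot all_order all_algebra finmap.
From mathcomp Require Import reals sequences exp.
From mathcomp Require Import ring lra zify.
Import Order.TTheory GRing.Theory Num.Theory.
Local Open Scope ring_scope.

Set Implicit Arguments. Unset Strict Implicit. Unset Printing Implicit Defensive.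

(** * Real inequalities: the cost of one contraction and its geometric decay *)

Section RealBounds.
Context {R : realType}.
Implicit Types (x c eta : R) (a b s : nat).

(** If [a / b <= 1/2], then [a * eta] is at least [4 * a / b] and [1 / (1 + 2 * x) <= 1 - x]
    suffices. Otherwise [a * eta] exceeds [2 * sqrt b], so the left side is at most [1 / b], while
    [1 - a / b >= 1 / b] because [a] and [b] are integers. *)
Lemma expR_le_one_minus a b eta : (a < b)%N -> 4 <= eta * Num.sqrt b%:R ->
  expR (- (a%:R * eta)) <= 1 - a%:R / b%:R :> R.
Proof.
move=> ab heta; have b0 : 0 < b%:R :> R by rewrite ltr0n; lia.
have a0 : 0 <= a%:R :> R by rewrite ler0n.
set r := Num.sqrt b%:R in heta *.
have rr : r ^+ 2 = b%:R by rewrite sqr_sqrtr // ltW.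
have r1 : 1 <= r by rewrite -(sqrtr1 R) ler_sqrt // ler1n; lia.
have r0 : 0 <= r by exact: le_trans ler01 r1.
have ab' : a%:R + 1 <= b%:R :> R by rewrite natr1 ler_nat.
set x := a%:R / b%:R.
have xb : x * b%:R = a%:R by rewrite mulfVK // gt_eqF.
have x0 : 0 <= x by rewrite divr_ge0 // ltW.
have key : 4 * x * r <= a%:R * eta.
  have h : 0 <= x * r * (eta * r - 4) by apply: (mulr_ge0 (mulr_ge0 x0 r0)); rewrite subr_ge0.
  rewrite -subr_ge0; apply: le_trans h _; rewrite -xb -rr.
  by rewrite le_eqVlt; apply/orP; left; apply/eqP; ring.
have [x12|x12] := lerP x (1/2).
  have h : 1 + 2 * x <= expR (a%:R * eta).
    apply: (le_trans _ (expR_ge1Dx _)); nra.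
  rewrite expRN -[1 - x]invrK lef_pV2 ?posrE ?invr_gt0 ?expR_gt0; try lra.
  apply: le_trans h; rewrite -[_^-1]mul1r ler_pdivrMr; nra.
have h : b%:R <= expR (a%:R * eta).
  apply: (@le_trans _ _ (expR (r + r))).
    have er : r <= expR r by apply: le_trans (expR_ge1Dx _); lra.
    by rewrite expRD -rr expr2; apply: ler_pM => //; lra.
  by rewrite ler_expR; nra.
have h2 : expR (- (a%:R * eta)) <= b%:R^-1.
  by rewrite expRN lef_pV2 // posrE ?expR_gt0.
apply: (le_trans h2); rewrite -[_^-1]mul1r ler_pdivrMr //.
by rewrite mulrBl xb mul1r; lra.
Qed.

Definition root4 s : R := Num.sqrt (Num.sqrt s%:R).

Lemma root4_gt0 s : (0 < s)%N -> 0 < root4 s.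
Proof. by move=> s0; rewrite !sqrtr_gt0 ltr0n. Qed.

Lemma root4_le s s' : (s <= s')%N -> root4 s <= root4 s'.
Proof. by move=> ss; rewrite !ler_wsqrtr // ler_nat. Qed.

Lemma root4M s s' : root4 (s * s') = root4 s * root4 s'.
Proof. by rewrite /root4 natrM sqrtrM ?ler0n // sqrtrM ?sqrtr_ge0. Qed.

Lemma root42_gt1 : 1 < root4 2.
Proof.
rewrite /root4 -{1}(sqrtr1 R) ltr_sqrt ?sqrtr_gt0 // -{1}(sqrtr1 R).
by rewrite ltr_sqrt // ltr1n.
Qed.

(* Chosen so that [C / root4 s] loses at least [4 / sqrt (c * sqrt s)] each
   time [s] doubles. *)
Definition contraction_rate c : R :=
  4 / ((1 - (root4 2)^-1) * Num.sqrt c).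

Lemma contraction_rate_gt0 c : 0 < c -> 0 < contraction_rate c.
Proof.
move=> c0; rewrite divr_gt0 // mulr_gt0 ?sqrtr_gt0 // subr_gt0.
by rewrite invf_lt1 ?root42_gt1 // root4_gt0.
Qed.

(** What one endpoint of a cut edge may still have to pay when its block has size [s]: the tail of
    the geometric series over future doublings. *)
Definition block_weight c s : R := contraction_rate c / root4 s.

Lemma block_weight_anti c s s' : 0 < c -> (0 < s)%N -> (s <= s')%N ->
  block_weight c s' <= block_weight c s.
Proof.
move=> c0 s0 ss; apply: ler_wpM2l; first exact/ltW/contraction_rate_gt0.
by rewrite lef_pV2 ?posrE ?root4_gt0 ?root4_le //; lia.
Qed.

(** The product is smallest at [s' = 2 * s] and [b = c * sqrt s], where the choice of
    [contraction_rate] makes it equal to 4. *)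
Lemma block_weight_drop c s s' b : 0 < c -> (0 < s)%N -> (2 * s <= s')%N ->
  c * Num.sqrt s%:R <= b%:R ->
  4 <= (block_weight c s - block_weight c s') * Num.sqrt b%:R.
Proof.
move=> c0 s0 ss hb.
have hC := contraction_rate_gt0 c0.
have r0 := root4_gt0 s0; have k1 := root42_gt1.
have k0 : 0 < root4 2 by lra.
have sb : Num.sqrt c * root4 s <= Num.sqrt b%:R.
  by rewrite /root4 -sqrtrM ?ler_wsqrtr // ltW.
have sc0 : 0 < Num.sqrt c by rewrite sqrtr_gt0.
have kv : (root4 2)^-1 < 1 by rewrite invf_lt1.
have h1 : block_weight c s' <= contraction_rate c / (root4 2 * root4 s).
  by rewrite -root4M; apply: block_weight_anti => //; lia.
have h2 : 4 = (block_weight c s - contraction_rate c / (root4 2 * root4 s))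
              * (Num.sqrt c * root4 s).
  rewrite /block_weight /contraction_rate; field.
  by rewrite !gt_eqF //= subr_gt0.
have h3 : 0 <= block_weight c s - contraction_rate c / (root4 2 * root4 s).
  rewrite subr_ge0 /block_weight ler_pM2l // lef_pV2 ?posrE ?mulr_gt0 //.
  by rewrite -{1}[root4 s]mul1r ler_pM2r // ltW.
rewrite [leLHS]h2; apply: ler_pM => //; first by rewrite mulr_ge0 // ltW.
by rewrite lerD2l lerN2.
Qed.

(** With [x = c * sqrt s], [expR x >= (x / 4) ^ 4] bounds the left side by [256 / (c ^ 4 * s ^ 2)];
    the right side is written so as to telescope in [s]. *)
Lemma expRN_sqrt_le c s : 0 < c -> (0 < s)%N ->
  expR (- (c * Num.sqrt s%:R)) <= 512 / c ^+ 4 * (s%:R^-1 - s.+1%:R^-1).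
Proof.
move=> c0 s0; set x := c * Num.sqrt s%:R.
have s0' : 0 < s%:R :> R by rewrite ltr0n.
have s1 : 1 <= s%:R :> R by rewrite ler1n.
have x0 : 0 < x by rewrite mulr_gt0 // sqrtr_gt0.
have hx : x ^+ 4 = c ^+ 4 * s%:R ^+ 2.
  by rewrite exprMn (_ : 4 = 2 * 2)%N // [X in _ * X]exprM sqr_sqrtr // ltW.
have h4 : x / 4 <= expR (x / 4) by apply: le_trans (expR_ge1Dx _); lra.
have h : x ^+ 4 / 256 <= expR x.
  have -> : expR x = expR (x / 4) ^+ 4 by rewrite -expRM_natl; congr expR; field.
  have -> : x ^+ 4 / 256 = (x / 4) ^+ 4 by field.
  by rewrite lerXn2r // ?nnegrE ?expR_ge0 //; lra.
rewrite expRN; apply: (@le_trans _ _ (x ^+ 4 / 256)^-1).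
  by rewrite lef_pV2 // posrE ?expR_gt0 // divr_gt0 ?exprn_gt0.
have c4 : 0 < c ^+ 4 by rewrite exprn_gt0.
rewrite hx -[s.+1%:R]natr1.
have -> : (c ^+ 4 * s%:R ^+ 2 / 256)^-1 = 256 / c ^+ 4 * (s%:R ^+ 2)^-1 :> R.
  by field; rewrite !gt_eqF.
have -> : 512 / c ^+ 4 * (s%:R^-1 - (s%:R + 1)^-1) =
   256 / c ^+ 4 * (2 / (s%:R * (s%:R + 1))) :> R.
  by field; rewrite !gt_eqF // ?ltr_wpDl //.
apply: ler_wpM2l; first by rewrite divr_ge0 // ltW.
rewrite -[leLHS]mul1r ler_pdivrMr ?exprn_gt0 // mulrAC ler_pdivlMr; last first.
  by rewrite mulr_gt0 //; lra.
nra.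
Qed.

End RealBounds.

(** * Contraction of a finite graph and the count of its minimal cuts *)

Section Contraction.
Context {R : realType} {W F : finType} (ends : F -> W * W).
Implicit Types (l : {ffun W -> W}) (A S X : {set W}) (e f : F) (x y z : W).

Definition edge_cut X : {set F} :=
  [set e | ((ends e).1 \in X) != ((ends e).2 \in X)].

(** Connectedness of [A] and of its complement, in terms of cuts: a nonempty proper part [S] of
    either side with [edge_cut S] inside [edge_cut A] would have no edge to the rest of that
    side. *)
Definition bond A : bool :=
  [forall S : {set W}, (S != set0) ==> (S \proper A) || (S \proper ~: A) ==>
     ~~ (edge_cut S \subset edge_cut A)].

(* A partition of the vertices is encoded by a labelling. *)
Definition block l x : {set W} := [set y | l y == l x].

Definition merge_labels l e : {ffun W -> W} :=
  [ffun z => if l z == l (ends e).1 then l (ends e).2 else l z].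

Definition saturated l A : bool :=
  [forall x, forall y, (l x == l y) ==> ((x \in A) == (y \in A))].

Lemma block_id l x : x \in block l x.
Proof. by rewrite inE. Qed.

Lemma saturatedP l A :
  reflect (forall x y, l x = l y -> (x \in A) = (y \in A)) (saturated l A).
Proof.
apply: (iffP forallP) => [h x y /eqP lxy|h x].
  by have /forallP/(_ y)/implyP/(_ lxy)/eqP := h x.
by apply/forallP => y; apply/implyP => /eqP /h ->.
Qed.

Lemma saturated_block_sub l A x : saturated l A -> x \in A -> block l x \subset A.
Proof.
by move=> /saturatedP h xA; apply/subsetP => y; rewrite inE => /eqP /h ->.
Qed.

Lemma saturated_setC l A : saturated l A -> saturated l (~: A).
Proof.
by move=> /saturatedP h; apply/saturatedP => x y lxy; rewrite !inE (h _ _ lxy).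
Qed.

Lemma saturated_merge l e A : saturated l A -> e \notin edge_cut A ->
  saturated (merge_labels l e) A.
Proof.
move=> /saturatedP h; rewrite inE negbK => /eqP eA.
apply/saturatedP => x y; rewrite !ffunE.
case: eqP => [/h->|_]; case: eqP => [/h->|_] // /h //; last by rewrite eA.
by move=> <-.
Qed.

Lemma block_merge_sub l e x : block l x \subset block (merge_labels l e) x.
Proof. by apply/subsetP => y; rewrite !inE !ffunE => /eqP ->. Qed.

Lemma cut_block_neq l x e : e \in edge_cut (block l x) -> l (ends e).1 != l (ends e).2.
Proof. by rewrite !inE; apply: contra => /eqP ->. Qed.

Lemma card_block_merge l x z e : e \in edge_cut (block l x) -> z \in block l x ->
  (forall y, #|block l x| <= #|block l y|)%N ->
  (2 * #|block l x| <= #|block (merge_labels l e) z|)%N.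
Proof.
move=> ex zx hmin.
have ne := cut_block_neq ex.
have -> : block (merge_labels l e) z = block l (ends e).1 :|: block l (ends e).2.
  have lz : merge_labels l e z = l (ends e).2.
    rewrite ffunE; move: ex zx; rewrite !inE => + /eqP ->.
    rewrite [l x == _]eq_sym; case: (_ == l x) => //=.
    by case: (_ =P l x) => // ->.
  apply/setP => y; rewrite !inE lz ffunE.
  by case: (l y =P l (ends e).1) => [_|_] //=; rewrite ?eqxx.
rewrite cardsU disjoint_setI0 ?cards0 ?subn0.
  by rewrite mul2n -addnn leq_add.
rewrite -setI_eq0; apply/eqP/setP => y; rewrite !inE.
by apply/negP => /andP[/eqP ->]; exact/negP.
Qed.

(** The label of the first endpoint disappears, which makes the number of labels a decreasing
    measure for [contraction_sum]. *)
Lemma merge_label_card l x e : e \in edge_cut (block l x) ->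
  (#|merge_labels l e @: setT| < #|l @: setT|)%N.
Proof.
move=> /cut_block_neq ne; apply: proper_card; apply/properP; split.
  by apply/subsetP => _ /imsetP[z _ ->]; rewrite ffunE; case: ifP => _; exact: imset_f.
exists (l (ends e).1); first exact: imset_f.
apply/negP => /imsetP[z _]; rewrite ffunE; case: eqP => [_ h|h /esym//].
by rewrite h eqxx in ne.
Qed.

Context (c : R) (c0 : 0 < c).
Hypothesis isop : forall S, (2 * #|S| <= #|W|)%N ->
  c * Num.sqrt #|S|%:R <= #|edge_cut S|%:R.

(** Potential for all that the boundary edges of [A] may still pay, each through the blocks of both
    its endpoints. *)
Definition energy l A : R :=
  \sum_(e in edge_cut A) (block_weight c #|block l (ends e).1| +
                     block_weight c #|block l (ends e).2|).

Lemma block_gt0 l x : (0 < #|block l x|)%N.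
Proof. by rewrite card_gt0; apply/set0Pn; exists x; exact: block_id. Qed.

Lemma energy_ge0 l A : 0 <= energy l A.
Proof.
have h s : 0 <= block_weight c s.
  by rewrite divr_ge0 ?sqrtr_ge0 ?ltW ?contraction_rate_gt0.
by apply: sumr_ge0 => e _; rewrite addr_ge0.
Qed.

(** A cut edge that also leaves the block of [x] has an endpoint there, whose block at least
    doubles; no other weight increases because blocks only grow. *)
Lemma energy_merge l x e A : e \in edge_cut (block l x) ->
  (forall y, #|block l x| <= #|block l y|)%N ->
  energy (merge_labels l e) A <= energy l A - #|edge_cut (block l x) :&: edge_cut A|%:R *
    (block_weight c #|block l x| - block_weight c (2 * #|block l x|)).
Proof.
move=> ex hmin; set eta := (_ - block_weight c (2 * _)).
rewrite lerBrDr setIC mulr_natl -sumr_const /energy.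
rewrite [X in _ <= X](bigID (mem (edge_cut (block l x)))) /=.
rewrite [X in X + _ <= _](bigID (mem (edge_cut (block l x)))) /= addrAC.
have mono z : block_weight c #|block (merge_labels l e) z| <= block_weight c #|block l z|.
  by apply: block_weight_anti => //; [exact: block_gt0|
     exact/subset_leq_card/block_merge_sub].
apply: lerD; last by apply: ler_sum => f _; apply: lerD; exact: mono.
under [X in _ + X <= _]eq_bigl do rewrite inE.
rewrite -big_split /=; apply: ler_sum => f /andP[_].
have big z : z \in block l x ->
    block_weight c #|block (merge_labels l e) z| + eta <= block_weight c #|block l z|.
  move=> zx; have -> : block l z = block l x.
    by apply/setP => y; move: zx; rewrite !inE => /eqP ->.
  rewrite /eta addrC -addrA gerDl addrC subr_le0.
  apply: block_weight_anti => //; last exact: card_block_merge.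
  by rewrite muln_gt0 block_gt0.
rewrite [f \in _]inE.
case: (boolP ((ends f).1 \in _)) => [/big h1 _|_].
  by rewrite addrAC; apply: lerD.
case: (boolP ((ends f).2 \in _)) => // /big h2 _.
by rewrite -addrA; apply: lerD.
Qed.

(* One step of the contraction: a uniform edge of the cut of a smallest block
   avoids [edge_cut A] with probability [1 - a / b], which the drop of the energy
   pays for. *)
Lemma contraction_step l x A : bond A -> (2 * #|A| <= #|W|)%N -> saturated l A ->
  (#|block l x| < #|A|)%N -> (forall y, #|block l x| <= #|block l y|)%N ->
  expR (- energy l A) <= #|edge_cut (block l x)|%:R^-1 *
    \sum_(e in edge_cut (block l x) | saturated (merge_labels l e) A)
      expR (- energy (merge_labels l e) A).
Proof.
move=> bA A2 sA xA hmin; set S := block l x.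
set a := #|edge_cut S :&: edge_cut A|; set b := #|edge_cut S|.
(* Not every boundary edge of [S] lies in [edge_cut A]: [S] is smaller than either side, hence a
   proper part of one, and [A] is a bond. *)
have ab : (a < b)%N.
  have S0 : S != set0 by rewrite -card_gt0 block_gt0.
  have Spr : (S \proper A) || (S \proper ~: A).
    have [xa|xa] := boolP (x \in A).
      apply/orP; left; rewrite properEcard xA andbT.
      exact: saturated_block_sub.
    apply/orP; right; rewrite properEcard saturated_block_sub ?inE //=.
      by move: A2; rewrite -(cardsC A) -/S in xA *; lia.
    exact: saturated_setC.
  move: bA => /forallP/(_ S); rewrite S0 Spr /= => nsub.
  rewrite /a /b ltn_neqAle subset_leq_card ?subsetIl // andbT.
  by apply: contra nsub => /eqP h; apply/setIidPl/eqP; rewrite eqEcard subsetIl h leqnn.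
set eta := block_weight c #|S| - block_weight c (2 * #|S|).
have hexp : expR (- (a%:R * eta)) <= 1 - a%:R / b%:R.
  apply: expR_le_one_minus => //; apply: block_weight_drop => //.
    exact: block_gt0.
  by apply: isop; rewrite -/S in xA *; lia.
have b0 : 0 < b%:R :> R by rewrite ltr0n; lia.
have a1 : 1 - a%:R / b%:R = b%:R^-1 * (b - a)%:R :> R.
  by rewrite natrB ?(ltnW ab) // mulrBr mulVf ?gt_eqF // mulrC.
have -> : - energy l A = - (a%:R * eta) + - (energy l A - a%:R * eta) by ring.
rewrite expRD; apply: (@le_trans _ _ (b%:R^-1 * (b - a)%:R *
   expR (- (energy l A - a%:R * eta)))).
  by rewrite -a1 ler_wpM2r // expR_ge0.
rewrite -mulrA ler_wpM2l ?invr_ge0 ?ler0n //.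
have -> : (b - a)%N = #|edge_cut S :\: edge_cut A| by rewrite cardsD.
rewrite mulr_natl -sumr_const.
rewrite [X in _ <= X](bigID (fun e => e \notin edge_cut A)) /=.
apply: ler_wpDr; first by apply: sumr_ge0 => *; exact: expR_ge0.
rewrite [X in _ <= X](eq_bigl (fun e => e \in edge_cut S :\: edge_cut A)); last first.
  move=> e; rewrite in_setD; have [eA|eA] := boolP (e \in edge_cut A); first by rewrite andbF.
  by rewrite andbT; case: (e \in edge_cut S) => //=; exact: saturated_merge.
apply: ler_sum => e; rewrite in_setD => /andP[_ eS].
by rewrite ler_expR lerN2; exact: energy_merge.
Qed.

Context (o : W) (m : nat).

(** Induction on the number of blocks: [contraction_step] bounds each term by an average over the
    contracted edge, and exchanging the sums leaves the claim for each merged labelling. *)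
Lemma contraction_sum l :
  \sum_(A : {set W} | [&& bond A, o \in A, (2 * #|A| <= #|W|)%N, #|A| == m
                        & saturated l A]) expR (- energy l A) <= 1.
Proof.
have [r] := ubnP #|l @: setT|; elim: r l => // r IH l hr.
(* A saturated [A] contains the block of its element [o]; having only [m] elements it equals that
   block once the block is this large, so at most one term is left. *)
have [mo|mo] := leqP m #|block l o|.
  apply: (@le_trans _ _ (\sum_(A : {set W} | A == block l o) 1)); last first.
    by rewrite big_pred1_eq.
  rewrite big_mkcond [leRHS]big_mkcond /=; apply: ler_sum => A _.
  case: ifP => [/and5P[_ oA _ /eqP Am sA]|_]; last by case: ifP.
  rewrite (_ : A == block l o); first by rewrite expR_le1 oppr_le0 energy_ge0.
  by rewrite eq_sym eqEcard saturated_block_sub // Am.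
pose x := [arg min_(x < o) #|block l x|]%N.
have hmin y : (#|block l x| <= #|block l y|)%N.
  by rewrite /x; case: arg_minnP => // z _; apply.
have xm : (#|block l x| < m)%N by exact: leq_ltn_trans (hmin o) mo.
set S := block l x in hmin xm *.
apply: (@le_trans _ _ (\sum_(A : {set W} | [&& bond A, o \in A, (2 * #|A| <= #|W|)%N, #|A| == m
                        & saturated l A]) #|edge_cut S|%:R^-1 * \sum_(e in edge_cut S | saturated (merge_labels l e) A)
      expR (- energy (merge_labels l e) A))).
  apply: ler_sum => A /and5P[bA oA A2 /eqP Am sA].
  by apply: contraction_step => //; rewrite Am.
rewrite -mulr_sumr.
(* Without a boundary the inverse is 0 by convention and the bound is trivial. *)
have [->|S0] := eqVneq #|edge_cut S| 0%N; first by rewrite invr0 mul0r.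
rewrite mulrC ler_pdivrMr ?ltr0n ?lt0n // mul1r.
rewrite (exchange_big_dep (fun e => e \in edge_cut S)) /=; last by move=> A e _ /andP[].
rewrite -[leRHS]sumr_const; apply: ler_sum => e eS.
have := IH (merge_labels l e) (leq_trans (merge_label_card eS) _).
move=> /(_ ltac:(by rewrite -ltnS)); apply: le_trans.
rewrite [X in _ <= X](bigID (saturated l)) /=.
apply: ler_wpDr; first by apply: sumr_ge0 => *; exact: expR_ge0.
rewrite le_eqVlt; apply/orP; left; apply/eqP; apply: eq_bigl => A.
by rewrite eS; case: (bond A); case: (o \in A); case: (2 * _ <= _)%N; case: (_ == m);
  case: (saturated l A) => //=; rewrite ?andbF ?andbT.
Qed.

(** For the partition into singletons every [A] is saturated and every endpoint has weight
    [contraction_rate c]. *)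
Lemma contraction_count :
  \sum_(A : {set W} | [&& bond A, o \in A, (2 * #|A| <= #|W|)%N & #|A| == m])
    expR (- (2 * contraction_rate c * #|edge_cut A|%:R)) <= 1.
Proof.
have := contraction_sum [ffun x => x]; apply: le_trans.
rewrite le_eqVlt; apply/orP; left; apply/eqP; apply: eq_big => [A|A _].
  rewrite (_ : saturated _ A) ?andbT //.
  by apply/saturatedP => x y; rewrite !ffunE => ->.
congr (expR (- _)); rewrite /energy.
have h x : block_weight c #|block [ffun x => x] x| = contraction_rate c.
  rewrite (_ : block _ x = [set x]) ?cards1 /block_weight /root4 ?sqrtr1 ?divr1 //.
  by apply/setP => y; rewrite !inE !ffunE.
by under eq_bigr do rewrite !h; rewrite sumr_const -mulr_natr; ring.
Qed.

Context (q : R).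
Hypotheses (q0 : 0 <= q) (hq : q <= expR (- (2 * contraction_rate c + 1))).

(** In the bound on [q], the factor [expR (- (2 * contraction_rate c))] per edge pays for
    [contraction_count]; the remaining [expR (- 1)] per edge becomes the right-hand side by
    isoperimetry. *)
Lemma sum_cut_le_size :
  \sum_(A : {set W} | [&& bond A, o \in A, (2 * #|A| <= #|W|)%N & #|A| == m])
    q ^+ #|edge_cut A| <= expR (- (c * Num.sqrt m%:R)).
Proof.
apply: (@le_trans _ _ (\sum_(A : {set W} |
    [&& bond A, o \in A, (2 * #|A| <= #|W|)%N & #|A| == m])
    expR (- (c * Num.sqrt m%:R)) *
    expR (- (2 * contraction_rate c * #|edge_cut A|%:R)))).
  apply: ler_sum => A /and4P[_ _ A2 /eqP Am].
  apply: (@le_trans _ _ (expR (- (2 * contraction_rate c + 1)) ^+ #|edge_cut A|)).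
    by rewrite lerXn2r // nnegrE expR_ge0.
  rewrite -expRM_natl -expRD ler_expR.
  have := isop A2; rewrite Am => h.
  by rewrite mulrN mulrDr mulr1 opprD addrC lerD // ?lerN2 // mulrC.
rewrite -mulr_sumr -[leRHS]mulr1 ler_wpM2l ?expR_ge0 //.
exact: contraction_count.
Qed.

End Contraction.

Lemma sum_cut_le {R : realType} {W F : finType} (ends : F -> W * W) (c : R) :
  0 < c ->
  (forall S : {set W}, (2 * #|S| <= #|W|)%N ->
    c * Num.sqrt #|S|%:R <= #|edge_cut ends S|%:R) ->
  forall (o : W) (N : nat) (q : R), (0 < N)%N ->
  0 <= q -> q <= expR (- (2 * contraction_rate c + 1)) ->
  \sum_(A : {set W} | [&& bond ends A, o \in A, (2 * #|A| <= #|W|)%N & (N <= #|A|)%N])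
    q ^+ #|edge_cut ends A| <= 512 / c ^+ 4 / N%:R.
Proof.
move=> c0 isop o N q N0 q0 hq.
pose M := (N + #|W|.+1)%N.
apply: (@le_trans _ _ (\sum_(N <= m < M) \sum_(A : {set W} |
      [&& bond ends A, o \in A, (2 * #|A| <= #|W|)%N & #|A| == m]) q ^+ #|edge_cut ends A|)).
  under [leRHS]eq_bigr do rewrite big_mkcond.
  rewrite exchange_big /= big_mkcond; apply: ler_sum => A _.
  case: ifP => [/and4P[bA oA A2 NA]|_]; last first.
    by apply: sumr_ge0 => m _; case: ifP => // _; rewrite exprn_ge0.
  rewrite (bigD1_seq #|A|) ?iota_uniq //=; last first.
    by rewrite mem_index_iota NA /M; have := max_card A; lia.
  rewrite bA oA A2 eqxx lerDl.
  by apply: sumr_ge0 => m _; case: ifP => // _; rewrite exprn_ge0.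
apply: (@le_trans _ _ (\sum_(N <= m < M) (512 / c ^+ 4 * (m%:R^-1 - m.+1%:R^-1)))).
  rewrite !big_nat; apply: ler_sum => m /andP[Nm _].
  apply: le_trans (sum_cut_le_size c0 isop o m q0 hq) _.
  by apply: expRN_sqrt_le => //; lia.
rewrite -mulr_sumr; apply: ler_wpM2l; first by rewrite divr_ge0 ?exprn_ge0 ?ltW.
have -> : \sum_(N <= m < M) (m%:R^-1 - m.+1%:R^-1) = N%:R^-1 - M%:R^-1 :> R.
  rewrite (eq_bigr (fun m => - m.+1%:R^-1 - (- m%:R^-1))); last first.
    by move=> m _; rewrite opprK addrC.
  by rewrite (telescope_sumr (fun m => - m%:R^-1)) ?leq_addr // opprK addrC.
by rewrite gerBl invr_ge0.
Qed.

From mathcomp Require Import all_classical all_reals all_analysis.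
Local Open Scope classical_set_scope.
Local Open Scope ring_scope.

(** * Probabilities of cylinder events and a criterion for null sets *)

Section Probability.
Context {R : realType} {dT : measure_display} {T : measurableType dT}
  (P : probability T R).

Lemma measurable_bigcap_seq {I : choiceType} (s : seq I) (F : I -> set T) :
  (forall i, measurable (F i)) -> measurable (\bigcap_(i in [set` s]) F i).
Proof. by move=> mF; apply: fin_bigcap_measurable => //; exact: finite_seq. Qed.

Lemma probability_cylinder {E : choiceType} (p : R) (A : E -> set T) (s t : seq E) :
  bernoulli_bond_percolation P p A -> uniq (s ++ t) ->
  P ((\bigcap_(e in [set` s]) A e) `&` (\bigcap_(e in [set` t]) ~` A e)) =
  (p ^+ size s * (1 - p) ^+ size t)%:E.
Proof.
move=> [mA [PA iA]]; elim: t s => [|e t IH] s.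
  rewrite cats0 => us; rewrite set_nil bigcap_set0 setIT iA // expr0 mulr1.
  congr (_%:E); under eq_bigr do rewrite PA /=.
  by rewrite big_const_seq count_predT iter_mulr_1.
move=> ust; have uset : uniq ((e :: s) ++ t).
  by rewrite -(perm_uniq (s1 := s ++ e :: t)) // perm_catC /= perm_cons perm_catC.
have ust' : uniq (s ++ t) by move: uset => /= /andP[].
have mO (u : seq E) : measurable (\bigcap_(e in [set` u]) A e).
  by apply: measurable_bigcap_seq; exact: mA.
have mC (u : seq E) : measurable (\bigcap_(e in [set` u]) ~` A e).
  by apply: measurable_bigcap_seq => i; exact: measurableC.
set X := (\bigcap_(e in [set` s]) A e) `&` (\bigcap_(e in [set` t]) ~` A e).
have -> : (\bigcap_(e in [set` s]) A e) `&` (\bigcap_(e in [set` e :: t]) ~` A e)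
    = X `\` A e.
  rewrite [X in _ `&` X]bigcap_seq big_cons -bigcap_seq setDE /X.
  by rewrite -!setIA; congr (_ `&` _); rewrite setIC.
have mX : measurable X by exact: measurableI.
transitivity (P X - P (X `&` A e))%E.
  apply: measureD => //.
  by apply: le_lt_trans (probability_le1 P mX) _; rewrite ltry.
have -> : X `&` A e = (\bigcap_(e in [set` e :: s]) A e) `&` (\bigcap_(e in [set` t]) ~` A e).
  by rewrite [X in _ = X `&` _]bigcap_seq big_cons -bigcap_seq /X setIC setIA.
rewrite (IH s) // (IH (e :: s)) // -EFinB /=; congr (_%:E).
by rewrite !exprS; ring.
Qed.

Lemma probability_closed {E : choiceType} (p : R) (A : E -> set T) (t : seq E) :
  bernoulli_bond_percolation P p A -> uniq t ->
  P (\bigcap_(e in [set` t]) ~` A e) = ((1 - p) ^+ size t)%:E.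
Proof.
move=> bA ut; have := @probability_cylinder _ _ _ [::] t bA ut.
by rewrite set_nil bigcap_set0 setTI expr0 mul1r.
Qed.

Lemma probability_bigsetU_le {I : finType} (Q : pred I) (F : I -> set T) :
  (forall i, measurable (F i)) ->
  (P (\big[setU/set0]_(i | Q i) F i) <= \sum_(i | Q i) P (F i))%E.
Proof.
move=> mF; suff [] : measurable (\big[setU/set0]_(i | Q i) F i) /\
   (P (\big[setU/set0]_(i | Q i) F i) <= \sum_(i | Q i) P (F i))%E by [].
elim/big_ind2 : _ => [|X x Y y [mX hX] [mY hY]|i _] //.
  by rewrite measure0.
by split; [exact: measurableU|apply: le_trans (measureU2 _ _ _) (leeD hX hY)].
Qed.

(** [Z] lies in the lower limit of the [Y n], an increasing union of tail intersections of measure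
    at most [eps]; continuity from below bounds it by [eps]. Intersecting over [eps = 1 / (j + 1)]
    gives a measurable null cover. *)
Lemma negligible_liminf (Z : set T) :
  (forall eps : R, 0 < eps -> exists Y : nat -> set T,
     [/\ forall n, measurable (Y n), forall n, (P (Y n) <= eps%:E)%E &
         forall t, Z t -> exists m, forall n, (m <= n)%N -> Y n t]) ->
  P.-negligible Z.
Proof.
move=> h.
have {}h (j : nat) : exists M, [/\ measurable M, (P M <= (j.+1%:R^-1)%:E)%E & Z `<=` M].
  have [|Y [mY PY ZY]] := h j.+1%:R^-1; first by rewrite invr_gt0.
  pose I m := \bigcap_(n in [set n | (m <= n)%N]) Y n.
  have mI m : measurable (I m) by apply: bigcap_measurableType.
  exists (\bigcup_m I m); split.
  - exact: bigcup_measurable.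
  - have ndI : nondecreasing_seq I.
      move=> m n mn; apply/subsetPset => t It k /= nk; apply: It => /=.
      exact: leq_trans nk.
    have cv := @nondecreasing_cvg_mu _ _ _ P _ mI (bigcup_measurable (fun m _ => mI m)) ndI.
    rewrite -(cvg_lim _ cv) //; apply: lime_le; first by apply/cvg_ex; eexists; exact: cv.
    apply: nearW => n /=; apply: le_trans (PY n); apply: le_measure; rewrite ?inE //.
    by move=> t; apply => /=.
  - by move=> t /ZY[m hm]; exists m => // n /=; exact: hm.
pose M j := sval (cid (h j)).
have hM j : [/\ measurable (M j), (P (M j) <= (j.+1%:R^-1)%:E)%E & Z `<=` M j].
  by rewrite /M; case: cid.
exists (\bigcap_j M j); split.
- by apply: bigcap_measurableType => j _; have [] := hM j.
- apply/eqP; rewrite -measure_le0; apply/lee_addgt0Pr => e e0.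
  rewrite add0e.
  have [j hj] : exists j : nat, j.+1%:R^-1 <= e.
    exists (Num.truncn e^-1); rewrite invf_ple ?posrE //.
    by rewrite ltW // truncnS_gt.
  apply: (@le_trans _ _ (P (M j))); last first.
    by have [_ hh _] := hM j; apply: le_trans hh _; rewrite lee_fin.
  apply: le_measure; rewrite ?inE //; last by move=> t; apply.
    by apply: bigcap_measurableType => i _; have [] := hM i.
  by have [] := hM j.
- by move=> t Zt j _; have [_ _] := hM j; apply.
Qed.

End Probability.

Lemma card_fset_set_image {I : finType} {T : choiceType} (g : I -> T)
    (S : {set I}) (K : set T) : injective g ->
  (forall t, K t <-> exists2 x, x \in S & g x = t) -> #|` fset_set K| = #|S|.
Proof.
move=> gI hK; have -> : K = [set` [fset g x | x in S]%fset].
  apply/seteqP; split => t /=.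
    by move=> /hK[x xS <-]; apply/imfsetP; exists x.
  by move=> /imfsetP[/= x xS ->]; apply/hK; exists x.
by rewrite set_fsetK card_imfset //= -cardE.
Qed.

(** The isoperimetric exponent is at least 1/2 for [d >= 2]; the contraction works with the square
    root. *)
Lemma sqrt_le_powR {R : realType} (d x : R) : 2 <= d -> 1 <= x ->
  Num.sqrt x <= x `^ ((d - 1) / d).
Proof.
move=> d2 x1; rewrite -powR12_sqrt; last by lra.
by rewrite ler_powR // ler_pdivlMr; lra.
Qed.

(** * Paths and the edges by which they leave a set *)

Section Connectivity.
Context {V E : choiceType} (ends : E -> V * V).

Lemma joins_sym e u w : joins ends e u w -> joins ends e w u.
Proof. by rewrite /joins => -[]; [right|left]. Qed.

Lemma conn_trans Q u v w : conn ends Q u v -> conn ends Q v w -> conn ends Q u w.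
Proof.
by elim=> [//|{}u x {}v e Qe j _ IH] /IH; exact: conn_step Qe j.
Qed.

Lemma conn1 (Q : E -> Prop) e u w : Q e -> joins ends e u w -> conn ends Q u w.
Proof. by move=> Qe j; exact: conn_step Qe j (conn_refl _ _ _). Qed.

Lemma conn_sym Q u v : conn ends Q u v -> conn ends Q v u.
Proof.
elim=> [x|x y z e Qe j _ IH]; first exact: conn_refl.
exact: conn_trans IH (conn1 Qe (joins_sym j)).
Qed.

Lemma conn_sub (Q Q' : E -> Prop) u v : (forall e, Q e -> Q' e) ->
  conn ends Q u v -> conn ends Q' u v.
Proof.
move=> h; elim=> [x|x y z e Qe j _ IH]; first exact: conn_refl.
exact: conn_step (h _ Qe) j IH.
Qed.

Lemma conn_crossing Q (K : set V) u v : conn ends Q u v -> K u -> ~ K v ->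
  exists e, Q e /\ (K (ends e).1 <-> ~ K (ends e).2).
Proof.
elim=> [x //|x y z e Qe j _ IH] Kx Kz.
have [Ky|Ky] := pselect (K y); first exact: IH.
by exists e; split=> //; case: j => -> /=; tauto.
Qed.

Lemma finite_induced_edges k (X : set V) : max_degree_le ends k ->
  finite_set X -> finite_set [set e | induced_edges ends X e].
Proof.
move=> hk fX; apply: (@sub_finite_set _ _ (\bigcup_(x in X) incident ends x)).
  by move=> e [h _]; exists (ends e).1 => //; left.
by apply: bigcup_finite => // x _; have [] := hk x.
Qed.

End Connectivity.

(** * The Peierls event of a finite induced subgraph *)

Section Peierls.
Context {R : realType} {V E : choiceType} (ends : E -> V * V) (X : set V).
Hypotheses (fX : finite_set X)
  (fE : finite_set [set e | induced_edges ends X e]).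

Let W : finType := fset_set X.
Let F : finType := fset_set [set e | induced_edges ends X e].

Lemma sub_vertexP (x : W) : X (val x).
Proof. by have := valP x; rewrite in_fset_set // inE. Qed.

Lemma sub_edgeP (f : F) : induced_edges ends X (val f).
Proof. by have := valP f; rewrite in_fset_set // inE. Qed.

Lemma fst_sub_edge (f : F) : (ends (val f)).1 \in fset_set X.
Proof. by rewrite in_fset_set // inE; have [] := sub_edgeP f. Qed.

Lemma snd_sub_edge (f : F) : (ends (val f)).2 \in fset_set X.
Proof. by rewrite in_fset_set // inE; have [] := sub_edgeP f. Qed.

Definition sub_ends (f : F) : W * W :=
  ([` fst_sub_edge f]%fset, [` snd_sub_edge f]%fset).

Definition trace (K : set V) : {set W} := finset (fun x : W => `[< K (val x) >]).

Lemma in_trace K (x : W) : (x \in trace K) = `[< K (val x) >].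
Proof. by rewrite inE. Qed.

Lemma sub_vertex_lift v : X v -> exists x : W, val x = v.
Proof.
move=> Xv; have h : v \in fset_set X by rewrite in_fset_set // inE.
by exists [` h]%fset.
Qed.

Lemma sub_edge_lift e : induced_edges ends X e -> exists f : F, val f = e.
Proof.
move=> he; have h : e \in fset_set [set e | induced_edges ends X e].
  by rewrite in_fset_set // inE.
by exists [` h]%fset.
Qed.

Lemma card_trace K : K `<=` X -> #|` fset_set K| = #|trace K|.
Proof.
move=> KX; apply: (@card_fset_set_image _ _ val); first exact: val_inj.
move=> v; split => [Kv|[x + <-]]; last by rewrite in_trace => /asboolP.
by have [x xv] := sub_vertex_lift (KX _ Kv); exists x => //; rewrite in_trace xv; exact/asboolP.
Qed.

Lemma in_cut_trace K (f : F) :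
  (f \in edge_cut sub_ends (trace K)) = `[< induced_boundary ends X K (val f) >].
Proof.
rewrite inE /= !in_trace /=; apply/idP/asboolP => [h|[_ h]].
  split; first exact: sub_edgeP.
  by move: h; do 2 case: asboolP => //; tauto.
by do 2 case: asboolP => //; tauto.
Qed.

Lemma card_cut_trace K :
  #|` fset_set (induced_boundary ends X K)| = #|edge_cut sub_ends (trace K)|.
Proof.
apply: (@card_fset_set_image _ _ val); first exact: val_inj.
move=> e; split => [he|[f + <-]]; last by rewrite in_cut_trace => /asboolP.
have [f fe] := sub_edge_lift he.1.
by exists f => //; rewrite in_cut_trace fe; exact/asboolP.
Qed.

Lemma trace_surj (S : {set W}) : exists2 K, K `<=` X & S = trace K.
Proof.
exists [set v | exists2 x, x \in S & val x = v].
  by move=> v [x _ <-]; exact: sub_vertexP.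
apply/setP => x; rewrite in_trace; apply/idP/asboolP => /= [xS|]; last first.
  by case=> y yS /val_inj <-.
by exists x.
Qed.

Lemma trace_setD K : trace (X `\` K) = finset.setC (trace K).
Proof.
apply/setP => x; rewrite finset.in_setC !in_trace; apply/asboolP/negP => [[_ nK] /asboolP //|h].
by split; [exact: sub_vertexP|move=> Kx; apply: h; exact/asboolP].
Qed.

Lemma card_sub_vertices : #|W| = #|` fset_set X|.
Proof. by rewrite cardfE. Qed.

Lemma cut_isoperimetry (c d : R) : 0 < c -> 2 <= d -> induced_ID ends X d c ->
  forall S : {set W}, (2 * #|S| <= #|W|)%N ->
    c * Num.sqrt #|S|%:R <= #|edge_cut sub_ends S|%:R.
Proof.
move=> c0 d2 hID S; have [K KX ->] := trace_surj S => S2.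
have fK : finite_set K by exact: sub_finite_set KX fX.
have := hID K KX fK; rewrite card_cut_trace card_trace // card_trace //.
have CK := cardsC (trace K); rewrite trace_setD; apply: le_trans.
rewrite ler_wpM2l ?(ltW c0) //.
rewrite (minn_idPl _); last by lia.
have [->|S0] := posnP #|trace K|; first by rewrite sqrtr0 powR_ge0.
by apply: sqrt_le_powR => //; rewrite ler1n.
Qed.

(** A nonempty proper part of a connected side [M] is left by an edge within [M], and such an edge
    has both endpoints on the same side of [K]. *)
Lemma bond_trace K : K `<=` X -> induced_connected ends K ->
  induced_connected ends (X `\` K) -> bond sub_ends (trace K).
Proof.
move=> KX cK cD; apply/forallP => S; have [L LX ->] := trace_surj S.
apply/implyP => /set0Pn[x xL]; apply/implyP => hpr.
have main (M : set V) : (trace L \proper trace M)%SET -> induced_connected ends M ->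
    (forall e, induced_edges ends M e -> ~ induced_boundary ends X K e) ->
    M `<=` X -> ~~ (edge_cut sub_ends (trace L) \subset edge_cut sub_ends (trace K))%SET.
  move=> /properP[/fintype.subsetP sLM [y yM yL]] cM hM MX.
  have xM := sLM _ xL.
  move: xL yL xM yM; rewrite !in_trace => /asboolP xL /asboolP yL /asboolP xM /asboolP yM.
  have [e [Me eL]] := conn_crossing (cM _ _ xM yM) xL yL.
  have eX : induced_edges ends X e by case: Me => h1 h2; split; exact: MX.
  have [f fe] := sub_edge_lift eX.
  apply/fintype.subsetPn; exists f; first by rewrite in_cut_trace fe; exact/asboolP.
  by rewrite in_cut_trace fe; apply/asboolP; exact: hM.
case/orP: hpr => hpr.
  by apply: (main K) => // e [h1 h2] [_]; tauto.
apply: (main (X `\` K)) => //; first by rewrite trace_setD.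
by move=> e [[_ h1] [_ h2]] [_]; tauto.
Qed.

Context {dT : measure_display} {T : measurableType dT} (P : probability T R)
  (a : E -> set T).

(** Some admissible set around [o] has a closed boundary; a finite union, ready for the union bound.
    The vertex [o] is taken in [V], so that it can be kept while [X] varies; for [o] outside [X] the
    event is empty. *)
Definition peierls (o : V) (N : nat) : set T :=
  \big[setU/set0]_(S : {set W} |
      [&& bond sub_ends S, [exists x in S, val x == o], (2 * #|S| <= #|W|)%N
        & (N <= #|S|)%N])
    \bigcap_(e in [set` [seq val f | f <- enum (edge_cut sub_ends S)]]) ~` a e.

Lemma in_peierls (K : set V) o N t : K `<=` X -> induced_connected ends K ->
  induced_connected ends (X `\` K) -> K o ->
  (2 * #|` fset_set K| <= #|` fset_set X|)%N -> (N <= #|` fset_set K|)%N ->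
  (forall e, induced_boundary ends X K e -> ~ a e t) -> peierls o N t.
Proof.
move=> KX cK cD Ko K2 KN hcl; rewrite /peierls (bigD1 (trace K)) /=; last first.
  rewrite bond_trace //= -card_trace // card_sub_vertices K2 KN !andbT.
  have [x xo] := sub_vertex_lift (KX _ Ko); apply/existsP; exists x.
  by rewrite in_trace xo; apply/andP; split; [exact/asboolP|exact/eqP].
left => e /= /mapP[f + ->]; rewrite mem_enum in_cut_trace => /asboolP.
exact: hcl.
Qed.

Lemma measurable_peierls o N : (forall e, measurable (a e)) ->
  measurable (peierls o N).
Proof.
move=> ma; apply: bigsetU_measurable => S _.
by apply: measurable_bigcap_seq => e; exact: measurableC.
Qed.

Lemma peierls_le (c d p : R) o N : 0 < c -> 2 <= d -> induced_ID ends X d c ->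
  bernoulli_bond_percolation P p a -> p <= 1 ->
  1 - expR (- (2 * contraction_rate c + 1)) <= p -> (0 < N)%N ->
  (P (peierls o N) <= (512 / c ^+ 4 / N%:R)%:E)%E.
Proof.
move=> c0 d2 hID ba p1 hp N0; have [Xo|Xo] := pselect (X o); last first.
  rewrite /peierls big_pred0 ?measure0.
    rewrite lee_fin -mulrA mulr_ge0 ?ler0n // mulr_ge0 ?invr_ge0 ?ler0n //.
    exact/exprn_ge0/ltW.
  move=> S; rewrite (_ : [exists x in S, val x == o] = false) ?andbF //.
  by apply/existsP => -[x /andP[_ /eqP xo]]; apply: Xo; rewrite -xo; exact: sub_vertexP.
have [x xo] := sub_vertex_lift Xo.
apply: le_trans (probability_bigsetU_le _ _ _) _.
  move=> S; apply: measurable_bigcap_seq => e; apply: measurableC; exact: ba.1.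
have h := sum_cut_le c0 (cut_isoperimetry c0 d2 hID) x N0 (q := 1 - p).
apply: (@le_trans _ _ (\sum_(S : {set W} | [&& bond sub_ends S, x \in S, (2 * #|S| <= #|W|)%N
        & (N <= #|S|)%N]) ((1 - p) ^+ #|edge_cut sub_ends S|)%:E)%E); last first.
  by rewrite sumEFin lee_fin; apply: h; lra.
rewrite le_eqVlt; apply/orP; left; apply/eqP; apply: eq_big => [S|S _].
  congr [&& _, _, _ & _]; apply/existsP/idP => [[y /andP[yS /eqP yo]]|xS].
    by rewrite (_ : x = y) //; apply: val_inj; rewrite xo yo.
  by exists x; rewrite xS xo eqxx.
rewrite (probability_closed ba) ?size_map -?cardE //.
by rewrite map_inj_uniq ?enum_uniq //; exact: val_inj.
Qed.

End Peierls.

(** * Cardinalities of finite sets *)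

Lemma card_fset_set_subset {T : choiceType} (A B : set T) : finite_set B ->
  A `<=` B -> (#|` fset_set A| <= #|` fset_set B|)%N.
Proof.
move=> fB AB; have fA : finite_set A by exact: sub_finite_set fB.
by apply: fsubset_leq_card; rewrite -fset_set_sub.
Qed.

Lemma card_fset_setD {T : choiceType} (A B : set T) : finite_set A -> B `<=` A ->
  (#|` fset_set B| + #|` fset_set (A `\` B)| = #|` fset_set A|)%N.
Proof.
move=> fA BA; have fB : finite_set B by exact: sub_finite_set fA.
rewrite fset_setD // cardfsD -fset_setI // (setIidr BA) subnKC //.
exact: card_fset_set_subset.
Qed.

Lemma card_bigcup_seq_le {I T : choiceType} (s : seq I) (G : I -> set T) (K : nat)
    (A : set T) : finite_set A ->
  (forall i, i \in s -> finite_set (G i)) ->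
  (forall i, i \in s -> (#|` fset_set (G i)| <= K)%N) ->
  A `<=` \bigcup_(i in [set` s]) G i -> (#|` fset_set A| <= size s * K)%N.
Proof.
elim: s A => [|i s IH] A fA fG hG hA.
  by rewrite (_ : A = set0) ?fset_set0 //; apply/seteqP; split => // x /hA[].
have fAi : finite_set (A `&` G i) by exact: sub_finite_set fA.
rewrite -(card_fset_setD fA (B := A `&` G i)) // mulSn leq_add //.
  apply: leq_trans (hG i _); last by rewrite mem_head.
  by apply: card_fset_set_subset => //; apply: fG; rewrite mem_head.
apply: IH.
- exact: finite_setD.
- by move=> j js; apply: fG; rewrite inE js orbT.
- by move=> j js; apply: hG; rewrite inE js orbT.
move=> x [Ax nG]; have [j /=] := hA _ Ax.
rewrite inE => /orP[/eqP ->|js] Gx; first by case: nG.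
by exists j.
Qed.

Lemma eventually_seq {T : choiceType} (Q : T -> nat -> Prop) (s : seq T) :
  (forall y, y \in s -> exists m, forall n, (m <= n)%N -> Q y n) ->
  exists m, forall n, (m <= n)%N -> forall y, y \in s -> Q y n.
Proof.
elim: s => [|x s IH] h; first by exists 0%N.
have [m1 h1] := h x (mem_head _ _).
have [|m2 h2] := IH; first by move=> y ys; apply: h; rewrite inE ys orbT.
exists (maxn m1 m2) => n; rewrite geq_max => /andP[n1 n2] y.
by rewrite inE => /orP[/eqP ->|ys]; [exact: h1|exact: h2].
Qed.

(** * Components of the complement of a connected set *)

Section Hull.
Context {V E : choiceType} (ends : E -> V * V).

Lemma joins_induced X e u w : joins ends e u w -> induced_edges ends X e -> X u /\ X w.
Proof. by rewrite /induced_edges => -[] -> [] /=. Qed.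

Lemma induced_joins (X : set V) e u w : joins ends e u w -> X u -> X w -> induced_edges ends X e.
Proof. by rewrite /induced_edges => -[] -> /=. Qed.

Lemma conn_mem (X : set V) u v : conn ends (induced_edges ends X) u v -> X u -> X v.
Proof.
elim=> [//|x y z e Xe j _ IH] _; apply: IH.
by have [] := joins_induced j Xe.
Qed.

Lemma conn_reachable (Q Q' : E -> Prop) w u v :
  (forall e x y, Q e -> joins ends e x y -> conn ends Q w x -> conn ends Q w y -> Q' e) ->
  conn ends Q w u -> conn ends Q u v -> conn ends Q' u v.
Proof.
move=> h wu uv; elim: uv wu => [x _|x y z e Qe j _ IH wx]; first exact: conn_refl.
have wy : conn ends Q w y by exact: conn_trans wx (conn1 Qe j).
exact: conn_step (h _ _ _ Qe j wx wy) j (IH wy).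
Qed.

Lemma reachable_connected (Q : E -> Prop) w :
  induced_connected ends [set y | conn ends Q w y].
Proof.
move=> u v /= wu wv.
apply: (@conn_reachable Q _ w) => //; last exact: conn_trans (conn_sym wu) wv.
by move=> e x y Qe j wx wy; exact: induced_joins j wx wy.
Qed.

Context (X C : set V) (o : V).
Hypotheses (cX : induced_connected ends X) (CX : C `<=` X) (Co : C o)
  (cC : induced_connected ends C).

(** The component of [w] in the complement of [C]. The first conjunct makes it empty for other [w],
    since [conn] is reflexive everywhere. *)
Definition residual (w : V) : set V :=
  [set y | (X `\` C) w /\ conn ends (induced_edges ends (X `\` C)) w y].

Lemma residual_refl w : (X `\` C) w -> residual w w.
Proof. by split => //; exact: conn_refl. Qed.

Lemma residual_sub w : residual w `<=` X `\` C.
Proof. by move=> y [hw /conn_mem]; exact. Qed.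

(** An edge of [X] leaving a component of the complement of [C] can only lead into [C]; otherwise
    the component would be larger. *)
Lemma residual_boundary w e : induced_boundary ends X (residual w) e ->
  induced_boundary ends X C e.
Proof.
move=> [[e1 e2] he]; split => //.
have step u v : joins ends e u v -> residual w u -> X v -> ~ C v -> residual w v.
  move=> j [hw hu] Xv Cv; split => //; apply: (conn_trans hu (conn1 _ j)).
  by apply: induced_joins j _ _ => //; exact: (conn_mem hu hw).
have j12 : joins ends e (ends e).1 (ends e).2 by left; case: (ends e).
have nC v : residual w v -> ~ C v by move=> /residual_sub[].
have := step _ _ j12; have := step _ _ (joins_sym j12).
have := nC (ends e).1; have := nC (ends e).2.
by have [|] := pselect (C (ends e).1); have [|] := pselect (C (ends e).2); tauto.
Qed.

Lemma residual_connected w : induced_connected ends (residual w).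
Proof.
move=> u v [hw wu] [_ wv].
rewrite (_ : residual w = [set y | conn ends (induced_edges ends (X `\` C)) w y]).
  exact: reachable_connected.
by apply/seteqP; split => y; [case|].
Qed.

(** A path in [X] from outside the component to [C] cannot enter the component before it meets [C],
    and [C] itself is connected. *)
Lemma hull_connected w : induced_connected ends (X `\` residual w).
Proof.
set D := residual w.
have CD : C `<=` X `\` D by move=> x Cx; split; [exact: CX|move=> /residual_sub[]].
have toC z v : conn ends (induced_edges ends X) z v -> C v -> (X `\` D) z ->
    exists2 x, C x & conn ends (induced_edges ends (X `\` D)) z x.
  elim=> [y Cy _|x y v' e Xe j _ IH Cv Dx]; first by exists y => //; exact: conn_refl.
  have [Cx|Cx] := pselect (C x); first by exists x => //; exact: conn_refl.
  have [Xx Xy] := joins_induced j Xe.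
  have Dy : (X `\` D) y.
    have [Cy|Cy] := pselect (C y); first exact: CD.
    split=> // -[hw wy]; apply: Dx.2; split => //; apply: conn_trans wy (conn1 _ (joins_sym j)).
    exact: induced_joins j _ _.
  have [x' Cx' h] := IH Cv Dy; exists x' => //.
  by apply: (conn_step _ j h); exact: induced_joins j _ _.
have toC' z : (X `\` D) z -> exists2 x, C x & conn ends (induced_edges ends (X `\` D)) z x.
  by move=> Dz; apply: (toC _ _ _ Co Dz); apply: cX; [case: Dz|exact: CX].
move=> u v /toC'[x Cx ux] /toC'[y Cy vy].
apply: conn_trans ux (conn_trans _ (conn_sym vy)).
by apply: conn_sub (cC Cx Cy) => e [h1 h2]; split; exact: CD.
Qed.

Lemma setDD_residual w : X `\` (X `\` residual w) = residual w.
Proof. by rewrite setDD setIidr // => x /residual_sub[]. Qed.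

Lemma hull_boundary w e : induced_boundary ends X (X `\` residual w) e ->
  induced_boundary ends X C e.
Proof.
move=> [[e1 e2] he]; apply: (@residual_boundary w); split => //.
move: he; rewrite /setD /=.
by have [|] := pselect (residual w (ends e).1);
   have [|] := pselect (residual w (ends e).2); tauto.
Qed.

(** Since [X] is connected, every component of the complement of [C] touches a boundary edge of [C];
    so these edges bound the number of components. *)
Lemma residual_cover y : (X `\` C) y ->
  exists e z, [/\ induced_boundary ends X C e, (ends e).1 = z \/ (ends e).2 = z & residual z y].
Proof.
move=> hy; have [Xy Cy] := hy.
have hyo : ~ residual y o by move=> /residual_sub[].
have [e [Xe he]] := conn_crossing (cX Xy (CX Co)) (residual_refl hy) hyo.
have be : induced_boundary ends X (residual y) e by split.
exists e; have sym z : residual y z -> residual z y.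
  move=> yz; split; first exact: residual_sub yz.
  by apply: conn_sym; case: yz.
have [h1|h1] := pselect (residual y (ends e).1).
  exists (ends e).1; split; [exact: residual_boundary be|by left|exact: sym].
exists (ends e).2; split; [exact: residual_boundary be|by right|].
by apply: sym; apply: contrapT; tauto.
Qed.

End Hull.

(** * Peierls events along the exhaustion *)

Section Exhaustion.
Context {V E : choiceType} (ends : E -> V * V) (k : nat) (Vn : nat -> set V).
Hypotheses (infV : ~ finite_set [set: V])
  (hk : max_degree_le ends k) (Vmono : forall n, Vn n `<=` Vn n.+1)
  (Vcover : \bigcup_n Vn n = [set: V]) (Vfin : forall n, finite_set (Vn n))
  (Vconn : forall n, induced_connected ends (Vn n)).

Lemma exhaustion_le m n : (m <= n)%N -> Vn m `<=` Vn n.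
Proof.
elim: n => [|n IH]; first by rewrite leqn0 => /eqP ->.
by rewrite leq_eqVlt => /orP[/eqP -> //|/IH h x /h]; exact: Vmono.
Qed.

Lemma vertex_eventually v : exists m, forall n, (m <= n)%N -> Vn n v.
Proof.
have : (\bigcup_n Vn n) v by rewrite Vcover.
by move=> [m _ Vv]; exists m => n mn; exact: exhaustion_le mn _ Vv.
Qed.

Lemma card_ge_eventually (A : nat -> set V) (B : set V) N :
  (forall n, finite_set (A n)) -> ~ finite_set B ->
  (forall y, B y -> exists m, forall n, (m <= n)%N -> A n y) ->
  exists m, forall n, (m <= n)%N -> (N <= #|` fset_set (A n)|)%N.
Proof.
move=> fA infB hB; have [S SB NS] := infinite_set_fset N infB.
have [|m hm] := @eventually_seq _ (fun y n => A n y) (enum_fset S).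
  by move=> y yS; apply: hB; exact: SB.
exists m => n /hm h; apply: leq_trans NS _; rewrite -{1}(set_fsetK S).
by apply: card_fset_set_subset (fA n) _ => y yS; exact: h.
Qed.

Lemma subset_eventually (A : set V) : finite_set A ->
  exists m, forall n, (m <= n)%N -> A `<=` Vn n.
Proof.
move=> fA.
have [|m hm] := @eventually_seq _ (fun y n => Vn n y) (enum_fset (fset_set A)).
  by move=> y _; exact: vertex_eventually.
by exists m => n /hm h y Ay; apply: h; rewrite in_fset_set // inE.
Qed.

Lemma exhaustion_card N : exists m, forall n, (m <= n)%N ->
  (N <= #|` fset_set (Vn n)|)%N.
Proof.
by apply: card_ge_eventually infV _ => // y _; exact: vertex_eventually.
Qed.

Lemma conn_eventually (Q : E -> Prop) u v : conn ends Q u v ->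
  exists m, forall n, (m <= n)%N ->
    conn ends (fun e => Q e /\ induced_edges ends (Vn n) e) u v.
Proof.
elim=> [x|x y z e Qe j _ [m hm]]; first by exists 0%N => n _; exact: conn_refl.
have [mx hx] := vertex_eventually x; have [my hy] := vertex_eventually y.
exists (maxn m (maxn mx my)) => n; rewrite !geq_max => /and3P[nm nx ny].
apply: (conn_step _ j (hm _ nm)); split => //.
by apply: (induced_joins j); [exact: hx|exact: hy].
Qed.

Context {dT : measure_display} {T : measurableType dT} (a : E -> set T).

Definition exhaustion_peierls n : V -> nat -> set T :=
  peierls (Vfin n) (finite_induced_edges hk (Vfin n)) a.

(** Take the cluster [C] of [u] inside [Vn n] and the component [D] of its complement that contains
    [w]. Then [D] and the rest of [Vn n] are connected, their common boundary is closed as part of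
    that of [C], and each contains one of the two clusters; the smaller side gives the event. *)
Lemma separated_peierls u w N t :
  infinite_cluster ends (fun e => a e t) u ->
  infinite_cluster ends (fun e => a e t) w ->
  ~ conn ends (fun e => a e t) u w ->
  exists m, forall n, (m <= n)%N ->
    exhaustion_peierls n u N t \/ exhaustion_peierls n w N t.
Proof.
move=> infu infw nuw.
pose Q n e := a e t /\ induced_edges ends (Vn n) e.
(* Clusters of the configuration restricted to [Vn n]; every vertex of the full cluster eventually
   enters them, so their sizes pass any [N]. *)
pose Cl x n : set V := [set y | Vn n x /\ conn ends (Q n) x y].
have ClV x n : Cl x n `<=` Vn n.
  move=> y [Vx /(conn_sub (Q' := induced_edges ends (Vn n)))].
  by move=> /(_ ltac:(by move=> e [])) /conn_mem; exact.
have fCl x n : finite_set (Cl x n) by exact: sub_finite_set (ClV x n) (Vfin n).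
have large x : infinite_cluster ends (fun e => a e t) x ->
    exists m, forall n, (m <= n)%N -> (N <= #|` fset_set (Cl x n)|)%N.
  move=> infx; apply: (card_ge_eventually N (fCl x) infx) => y xy.
  have [m1 h1] := vertex_eventually x; have [m2 h2] := conn_eventually xy.
  exists (maxn m1 m2) => n; rewrite geq_max => /andP[n1 n2].
  by split; [exact: h1|exact: h2].
have [mu hu] := large u infu; have [mw hw] := large w infw.
have [m1 h1] := vertex_eventually u; have [m2 h2] := vertex_eventually w.
exists (maxn (maxn mu mw) (maxn m1 m2)) => n.
rewrite !geq_max => /andP[/andP[/hu nu /hw nw] /andP[/h1 Vu /h2 Vw]].
set X := Vn n; pose C := Cl u n.
have Cu : C u by split => //; exact: conn_refl.
have cC : induced_connected ends C.
  rewrite (_ : C = [set y | conn ends (Q n) u y]); first exact: reachable_connected.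
  by apply/seteqP; split => y; [case|].
have nwC y : conn ends (Q n) w y -> ~ C y.
  move=> wy [_ uy]; apply: nuw; apply: (@conn_sub _ _ _ (Q n)) => [e []//|].
  exact: conn_trans uy (conn_sym wy).
set D := residual ends X C w.
have wD : Cl w n `<=` D.
  move=> y [_ wy]; split; first by split => //; apply: nwC; exact: conn_refl.
  apply: (@conn_reachable _ _ _ (Q n) _ w) => //; last exact: conn_refl.
  move=> e x z [_ Xe] j wx wz; have [Xx Xz] := joins_induced j Xe.
  by apply: (induced_joins j); split => //; exact: nwC.
have closed e : induced_boundary ends X C e -> ~ a e t.
  move=> [Xe he] ae; have j12 : joins ends e (ends e).1 (ends e).2 by left; case: (ends e).
  have step x y : joins ends e x y -> C x -> C y.
    by move=> j [_ ux]; split => //; apply: (conn_trans ux); apply: (conn1 _ j).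
  by have := step _ _ j12; have := step _ _ (joins_sym j12); tauto.
have fX := Vfin n.
have DX : D `<=` X by move=> y Dy; have [] := residual_sub Dy.
have fD : finite_set D by exact: sub_finite_set DX fX.
have CX : C `<=` X by exact: ClV.
have CDX : C `<=` X `\` D by move=> y Cy; split; [exact: CX|move=> Dy; have [] := residual_sub Dy].
have ND : (N <= #|` fset_set D|)%N.
  by apply: leq_trans nw _; exact: card_fset_set_subset.
have NC : (N <= #|` fset_set (X `\` D)|)%N.
  by apply: leq_trans nu _; apply: card_fset_set_subset => //; exact: finite_setD.
have sumD := card_fset_setD fX DX.
have cD : induced_connected ends D by exact: residual_connected.
have cA : induced_connected ends (X `\` D) by exact: (hull_connected (@Vconn n) CX Cu cC).
have [half|half] := leqP (2 * #|` fset_set D|) #|` fset_set X|.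
  right; apply: (@in_peierls _ _ _ _ _ _ _ _ a (D)) => //.
    by apply: wD; split => //; exact: conn_refl.
  by move=> e /residual_boundary; exact: closed.
left; apply: (@in_peierls _ _ _ _ _ _ _ _ a (X `\` D)) => //.
- by rewrite setDD_residual.
- exact: CDX.
- by rewrite -/X in half sumD *; lia.
- by move=> e /hull_boundary; exact: closed.
Qed.

Context {R : realType} (c d : R).
Hypotheses (c0 : 0 < c) (d2 : 2 <= d)
  (VID : forall n, induced_ID ends (Vn n) d c).

(** The union [C] of the clusters meeting [Vn n0] is finite, so its boundary is bounded
    independently of [n]. For large [n] some component of the rest is large, and isoperimetry forces
    its complement, which contains [C], to be small: this complement is the required set. *)
Lemma extinct_peierls n0 o t : Vn n0 o ->
  (forall v, finite_set [set y | conn ends (fun e => a e t) v y]) ->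
  exists m, forall n, (m <= n)%N ->
    exhaustion_peierls n o #|` fset_set (Vn n0)| t.
Proof.
move=> Vo finC.
pose C := \bigcup_(x in Vn n0) [set y | conn ends (fun e => a e t) x y].
have fC : finite_set C by apply: bigcup_finite.
have VC : Vn n0 `<=` C by move=> x Vx; exists x => //=; exact: conn_refl.
pose G := \bigcup_(x in C) incident ends x.
have fG : finite_set G by apply: bigcup_finite => // x _; have [] := hk x.
set g := #|` fset_set G|.
(* By isoperimetry, two complementary parts both larger than [K0] have more than [g] boundary
   edges. *)
have [K0 hK0] : exists K0 : nat, forall s : nat, (K0 < s)%N ->
    g%:R < c * s%:R `^ ((d - 1) / d).
  exists (Num.truncn ((g%:R / c) ^+ 2)) => s hs.
  have s1 : 1 <= s%:R :> R by rewrite ler1n; lia.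
  apply: (@lt_le_trans _ _ (c * Num.sqrt s%:R)); last first.
    by rewrite ler_wpM2l ?(ltW c0) // sqrt_le_powR.
  rewrite mulrC -ltr_pdivrMr //.
  have gc : 0 <= g%:R / c by rewrite divr_ge0 // ltW.
  rewrite -(@ltr_pXn2r _ 2) // ?nnegrE ?sqrtr_ge0 // sqr_sqrtr //.
  by apply: lt_le_trans (truncnS_gt _) _; rewrite ler_nat.
have [m1 h1] := subset_eventually fC.
(* Room for [C], for [g] pairs of components of size at most [K0], and for twice a set of size [K0],
   which is then at most half of [Vn n]. *)
have [m2 h2] := exhaustion_card (#|` fset_set C| + g * (2 * K0) + 2 * K0).+1.
exists (maxn n0 (maxn m1 m2)) => n; rewrite !geq_max => /and3P[n0n /h1 CX /h2 hcard].
set X := Vn n in CX hcard *.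
have fX : finite_set X by exact: Vfin.
have Co : C o by exact: VC.
have cC : induced_connected ends C.
  have toV u : C u -> exists2 x, Vn n0 x & conn ends (induced_edges ends C) x u.
    move=> [x Vx /= xu]; exists x => //.
    apply: (@conn_reachable _ _ _ (fun e => a e t) _ x) => //; last exact: conn_refl.
    by move=> e y z _ j xy xz; apply: (induced_joins j); exists x.
  move=> u v /toV[x Vx xu] /toV[y Vy yv].
  apply: conn_trans (conn_sym xu) (conn_trans _ yv).
  by apply: conn_sub (Vconn Vx Vy) => e [e1 e2]; split; exact: VC.
have closed e : induced_boundary ends X C e -> ~ a e t.
  move=> [Xe he] ae; have j12 : joins ends e (ends e).1 (ends e).2 by left; case: (ends e).
  have step x y : joins ends e x y -> C x -> C y.
    by move=> j [z Vz /= zx]; exists z => //=; apply: (conn_trans zx); exact: (conn1 _ j).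
  by have := step _ _ j12; have := step _ _ (joins_sym j12); tauto.
have bG e : induced_boundary ends X C e -> G e.
  move=> [_ he]; have [h|h] := pselect (C (ends e).1).
    by exists (ends e).1 => //; left.
  by exists (ends e).2; [apply: contrapT; tauto|right].
pose D := residual ends X C.
have DX w : D w `<=` X by move=> y Dy; have [] := residual_sub Dy.
have fD w : finite_set (D w) by exact: sub_finite_set (DX w) fX.
(* Otherwise components of size at most [K0], two for each edge of [G], would cover the rest of
   [Vn n], against its size. *)
have [w hw] : exists w, (K0 < #|` fset_set (D w)|)%N.
  apply: contrapT => hn.
  have small w : (#|` fset_set (D w)| <= K0)%N.
    by rewrite leqNgt; apply/negP => h; apply: hn; exists w.
  have cov : X `\` C `<=` \bigcup_(e in [set` enum_fset (fset_set G)])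
      (D (ends e).1 `|` D (ends e).2).
    move=> y /(residual_cover (@Vconn n) CX Co)[e [z [be ez zy]]].
    exists e => /=; first by rewrite in_fset_set // inE; exact: bG.
    by case: ez => ->; [left|right].
  have := card_bigcup_seq_le (K := (2 * K0)%N) (finite_setD _ fX) _ _ cov.
  have sumC := card_fset_setD fX CX.
  move=> h; suff : (#|` fset_set (X `\` C)| <= g * (2 * K0))%N by lia.
  apply: h => e _; first by rewrite finite_setU.
  rewrite fset_setU //; apply: leq_trans (leq_card_fsetU _ _) _.
  by have := small (ends e).1; have := small (ends e).2; lia.
have sumD := card_fset_setD fX (DX w).
have hull_small : (#|` fset_set (X `\` D w)| <= K0)%N.
  rewrite leqNgt; apply/negP => hA.
  have := VID (DX w) (fD w).
  rewrite leNgt => /negP; apply; apply: le_lt_trans (hK0 _ _); last first.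
    by rewrite leq_min; apply/andP; split; [exact: hw|exact: hA].
  rewrite ler_nat; apply: card_fset_set_subset => // e /residual_boundary.
  exact: bG.
have CDX : C `<=` X `\` D w by move=> y Cy; split; [exact: CX|move=> Dy; have [] := residual_sub Dy].
apply: (@in_peierls _ _ _ _ _ _ _ _ a (X `\` D w)) => //.
- exact: (hull_connected (@Vconn n) CX Co cC).
- by rewrite setDD_residual; exact: residual_connected.
- exact: CDX.
- by rewrite -/X; lia.
- apply: card_fset_set_subset; first exact: finite_setD.
  by apply: subset_trans CDX.
- by move=> e /hull_boundary; exact: closed.
Qed.

End Exhaustion.

(** * Nullity of the configurations with no infinite cluster or with two of them *)

Theorem theorem1p7 (R : realType) (k : nat) (c d : R) :
  0 < c -> 6 + 2 * Num.sqrt 7 < d ->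
  exists eps : R, 0 < eps /\
    forall (V E : choiceType) (ends : E -> V * V),
      simple_graph ends ->
      ~ finite_set [set: V] ->
      connected_graph ends ->
      max_degree_le ends k ->
      forall Vn : nat -> set V,
        (forall n, Vn n `<=` Vn n.+1) ->
        \bigcup_n Vn n = [set: V] ->
        (forall n, finite_set (Vn n)) ->
        (forall n, induced_connected ends (Vn n)) ->
        (forall n, induced_ID ends (Vn n) d c) ->
      forall p : R, 1 - eps <= p -> p <= 1 ->
      forall (dT : measure_display) (T : measurableType dT)
             (P : probability T R) (A : E -> set T),
        bernoulli_bond_percolation P p A ->
        {ae P, forall t, unique_infinite_cluster ends (fun e => A e t)}.
Proof.
(* The bound that [sum_cut_le] puts on [q = 1 - p]. *)
move=> c0 hd; exists (expR (- (2 * contraction_rate c + 1))).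
split; first exact: expR_gt0.
have d2 : 2 <= d by have := sqrtr_ge0 (7 : R); lra.
move=> V E ends _ infV _ hk Vn Vmono Vcover Vfin Vconn VID p hp p1 dT T P A bA.
set B := 512 / c ^+ 4.
have B0 : 0 < B by rewrite mulr_gt0 ?ltr0n // invr_gt0 exprn_gt0.
pose Y := exhaustion_peierls hk Vfin A.
have mY n o N : measurable (Y n o N) by apply: measurable_peierls; exact: bA.1.
have PY n o N : (0 < N)%N -> (P (Y n o N) <= (B / N%:R)%:E)%E.
  by move=> N0; apply: (@peierls_le _ _ _ _ _ _ _ _ _ P _ _ _ _ _ _ c0 d2 (@VID n) bA) => //; lra.
have small (e : R) : 0 < e -> exists2 N, (0 < N)%N & forall n, (N <= n)%N -> B / n%:R <= e.
  move=> e0; exists (Num.truncn (B / e)).+1 => // n hn.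
  rewrite ler_pdivrMr ?ltr0n ?(leq_trans _ hn) // mulrC -ler_pdivrMr //.
  by apply/ltW; apply: lt_le_trans (truncnS_gt _) _; rewrite ler_nat.
pose Z0 := [set t | forall v, finite_set [set y | conn ends (fun e => A e t) v y]].
(* Both vertices are confined to the finite set [Vn m], so that a union bound over it is available;
   the countable union over [m] recovers all pairs. *)
pose Z m := [set t | exists u w, [/\ Vn m u, Vn m w,
  infinite_cluster ends (fun e => A e t) u,
  infinite_cluster ends (fun e => A e t) w &
  ~ conn ends (fun e => A e t) u w]].
suff h : P.-negligible (Z0 `|` \bigcup_m Z m).
  apply: negligibleS h => t /= nt.
  have [[v infv]|fin] := pselect (exists v, infinite_cluster ends (fun e => A e t) v); last first.
    by left => v; apply: contrapT => h; apply: fin; exists v.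
  right; apply: contrapT => hZ; apply: nt; split; first by exists v.
  move=> u w infu infw; apply: contrapT => nuw; apply: hZ.
  have [m1 h1] := vertex_eventually Vmono Vcover u.
  have [m2 h2] := vertex_eventually Vmono Vcover w.
  exists (maxn m1 m2) => //; exists u, w; split => //.
    by apply: h1; rewrite leq_maxl.
  by apply: h2; rewrite leq_maxr.
apply: negligibleU.
  apply: negligible_liminf => e e0; have [N N0 hN] := small e e0.
  have [m hm] := exhaustion_card infV Vmono Vcover Vfin N.
  have cardm := hm m (leqnn m).
  have [x Vx] : exists x, Vn m x.
    apply: contrapT => h; move: cardm; rewrite (_ : Vn m = set0).
      by rewrite fset_set0 cardfs0; lia.
    by apply/seteqP; split => // y Vy; apply: h; exists y.
  exists (fun n => Y n x #|` fset_set (Vn m)|); split => //.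
    move=> n; apply: le_trans (PY _ _ _ _) _; first exact: leq_trans cardm.
    by rewrite lee_fin hN.
  by move=> t Zt; exact: (extinct_peierls infV hk Vmono Vcover Vfin Vconn c0 d2 VID Vx Zt).
apply: negligible_bigcup => m; apply: negligible_liminf => e e0.
pose W : finType := fset_set (Vn m).
have [|N N0 hN] := small (e / #|W|.+1%:R); first by rewrite divr_gt0.
(* Which vertex is enclosed depends on [n] and on the configuration, so all vertices of [Vn m] are
   taken, each with its share of [e]. *)
exists (fun n => \big[setU/set0]_(x : W) Y n (val x) N); split.
- by move=> n; apply: bigsetU_measurable.
- move=> n; apply: le_trans (probability_bigsetU_le P _ _) _ => //.
  apply: (@le_trans _ _ (\sum_(x : W) (e / #|W|.+1%:R)%:E)%E).
    apply: lee_sum => x _; apply: le_trans (PY _ _ _ N0) _.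
    by rewrite lee_fin hN.
  rewrite sumEFin lee_fin sumr_const -[X in X <= _]mulr_natr -mulrA ler_piMr ?(ltW e0) //.
  by rewrite mulrC ler_pdivrMr // mul1r ler_nat.
move=> t [u [w [Vu Vw infu infw nuw]]].
have [m' hm'] := separated_peierls hk Vmono Vcover Vfin Vconn N infu infw nuw.
have lift v : Vn m v -> exists x : W, val x = v by exact: sub_vertex_lift.
exists m' => n /hm'[hu|hw].
  by have [x xu] := lift _ Vu; rewrite (bigD1 x) //=; left; rewrite xu.
by have [x xw] := lift _ Vw; rewrite (bigD1 x) //=; left; rewrite xw.
Qed.
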